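(* Let $K$ be a real-closed, non-Archimedean-ordered valued field with valuation $v$ and residue field $k$ (which is also assumed real-closed). Let $P(x)=\sum_{i=0}^n c_ix^i\in K[x]$ with $c_n\neq0$. Suppose the Newton polygon of $P$ has edges $\sigma_1,\dots,\sigma_r$ with slopes $\lambda_1,\dots,\lambda_r$, and let $P_j=\sum\{\operatorname{sign}(c_i)x^i : (i,v(c_i))\in\sigma_j\}$. Factor $P=c_nQ(x)\prod_{i=1}^l(x-\alpha_i)$ where $\alpha_1,\dots,\alpha_l\in K$ are the roots of $P$ in $K$ (listed with multiplicity) and $Q\in K[x]$ has no roots in $K$. Then (1) for every $i$ there exists $j$ with $v(\alpha_i)=-\lambda_j$; (2) for every $j$, $\Delta(P_j)\ge\#\{i: v(\alpha_i)=-\lambda_j,\ \alpha_i>0\}$, and the two quantities differ by an even number.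
   Context: A valued field is a field $K$ with a map $v:K\to\mathbb{R}\cup\{\infty\}$ such that $v(0)=\infty$, $v$ restricted to $K^\times$ is a group homomorphism to $(\mathbb{R},+)$, and $v(x+y)\ge\min\{v(x),v(y)\}$. Its valuation ring is $\mathcal{O}_K=\{v\ge0\}$, with maximal ideal $\{v>0\}$ and residue field $k$. A real-closed field has a unique ordering ($x\ge0$ iff $x$ is a square), giving $\operatorname{sign}:K\to\{-1,0,1\}$. ''Non-Archimedean-ordered'' means $\mathcal{O}_K$ is convex for this ordering (i.e., if $x\in K$ satisfies $-a\le x\le a$ for some $a\in\mathcal{O}_K$ then $x\in\mathcal{O}_K$); the residue field is then real, and it is assumed real-closed. The Newton polygon of $P$ is the lower convex hull of the points $(i,v(c_i))$, $i=0,\dots,n$ (with $v(c_i)<\infty$); its edges are its bounded edges. For a polynomial over $\{-1,0,1\}$ or over an ordered field, $\Delta$ is the number of sign changes in its sequence of coefficients, ignoring zeros.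
   Formalization: Part (1) is stated only for nonzero roots: if c_0 = 0 then 0 is a root with v(0) = ∞, which equals no −λ_j (for example P = x, whose Newton polygon has no edges); the real-closedness of k is not assumed. *)

(* Defs.v *)
From HB Require Import structures.
From mathcomp Require Import all_boot all_order all_algebra.
From mathcomp Require Import reals.
Set Implicit Arguments. Unset Strict Implicit. Unset Printing Implicit Defensive.
Import Order.TTheory GRing.Theory Num.Theory.
Local Open Scope ring_scope.

(* A real-valued valuation on K^x.  The value v 0 is irrelevant: it plays the
   role of +oo and is never used (all statements only evaluate v at nonzero
   elements). *)
Definition is_valuation (R : realType) (K : rcfType) (v : K -> R) : Prop :=
  (forall x y : K, x != 0 -> y != 0 -> v (x * y) = v x + v y) /\
  (forall x y : K, x != 0 -> y != 0 -> x + y != 0 ->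
      Num.min (v x) (v y) <= v (x + y)).

Definition in_valring (R : realType) (K : rcfType) (v : K -> R) (x : K) : bool :=
  (x == 0) || (0 <= v x).

Definition valring_convex (R : realType) (K : rcfType) (v : K -> R) : Prop :=
  forall a x : K, in_valring v a -> - a <= x <= a -> in_valring v x.

Definition np_slope (R : realType) (K : rcfType) (v : K -> R) (P : {poly K})
  (a b : nat) : R :=
  (v P`_b - v P`_a) / (b%:R - a%:R).

Definition np_on_line (R : realType) (K : rcfType) (v : K -> R) (P : {poly K})
  (a b i : nat) : bool :=
  (P`_i != 0) && (v P`_i == v P`_a + np_slope v P a b * (i%:R - a%:R)).

(* [a,b] with a < b indexes a (bounded) edge of the Newton polygon of P,
   i.e. of the lower convex hull of {(i, v c_i) : c_i <> 0}: the line through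
   the two endpoints supports all points from below, and a, b are the extreme
   indices of the points on that line. *)
Definition np_edge (R : realType) (K : rcfType) (v : K -> R) (P : {poly K})
  (a b : nat) : Prop :=
  (a < b)%N /\ (b < size P)%N /\ P`_a != 0 /\ P`_b != 0 /\
  (forall i : nat, P`_i != 0 ->
     v P`_a + np_slope v P a b * (i%:R - a%:R) <= v P`_i) /\
  (forall i : nat, np_on_line v P a b i -> (a <= i <= b)%N).

Definition np_edge_poly (R : realType) (K : rcfType) (v : K -> R) (P : {poly K})
  (a b : nat) : {poly int} :=
  \poly_(i < size P) (if np_on_line v P a b i then sgz P`_i else 0).

Fixpoint changes_nz (T : numDomainType) (s : seq T) : nat :=
  match s with
  | x :: ((y :: _) as t) => addn (nat_of_bool (x * y < 0)) (changes_nz t)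
  | _ => 0%N
  end.

Definition sign_changes (T : numDomainType) (p : {poly T}) : nat :=
  changes_nz [seq x <- (p : seq T) | x != 0].

(* Main.v *)
(* If alpha is a nonzero root of P and w = v alpha, the minimum m of
   v c_i + i w must be attained at least twice, so - w is the slope of an edge.
   For the count, write P = B * \prod (X - alpha) over the positive roots alpha
   with v alpha = w.  Multiplying by one such X - alpha replaces the edge signs
   g_i by signs compatible with g_(i-1) - g_i, since by convexity the terms off
   the edge are infinitesimal compared with those on it; as in Descartes' rule,
   this increases the number of sign changes by a positive odd number.  For B
   itself the number is even: rescale by y > 0 with v y = w so that the two end
   terms of the edge have equal valuation.  A Cauchy bound then gives two
   points of valuation w where B has the signs of its two end coefficients;
   every point between them has valuation w, so B has no root there. *)

Require Import Defs.
From HB Require Import structures.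
From mathcomp Require Import all_boot all_order all_algebra.
From mathcomp Require Import reals zify ring lra.
Import Order.TTheory GRing.Theory Num.Theory.
Local Open Scope ring_scope.

(** * Sign variations of integer sequences *)

(** [x] is the last nonzero entry read so far; carrying it lets inductions skip zeros without
    filtering. *)
Fixpoint changes_from (x : int) (s : seq int) : nat :=
  if s is y :: t then
    if y == 0 then changes_from x t else ((x * y < 0)%R + changes_from y t)%N
  else 0%N.

Definition last_nonzero (x : int) (s : seq int) : int :=
  foldl (fun a y => if y == 0 then a else y) x s.

Definition variations (s : seq int) : nat := changes_nz [seq x <- s | x != 0].

Lemma variations_cons (x : int) (s : seq int) :
  variations (x :: s) = if x == 0 then variations s else changes_from x s.
Proof.
rewrite /variations /=; case: eqP => [//|_] /=.
elim: s x => [|y s IHs] x //=; case: eqP => [_|_] /=; first exact: IHs.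
by rewrite -IHs.
Qed.

Lemma sgz_mul_lt0 (x y : int) : (x * y < 0) = (0 < x) && (y < 0) || (x < 0) && (0 < y).
Proof.
case: (sgrP x) => [->|x_gt0|x_lt0]; first by rewrite mul0r.
  by rewrite pmulr_rlt0 //= orbF.
by rewrite nmulr_rlt0 //=.
Qed.

Lemma changes_from_le (x y : int) (s : seq int) :
  (changes_from x s <= (changes_from y s).+1)%N.
Proof.
elim: s x y => [|z s IHs] x y //=; case: eqP => [_|_]; first exact: IHs.
by rewrite -addSn leq_add2r (leq_trans (leq_b1 _)).
Qed.

Lemma last_nonzero_neq0 (x : int) (s : seq int) :
  x != 0 -> last_nonzero x s != 0.
Proof. by elim: s x => [|y s IHs] x x_neq0 //=; case: ifPn => ?; exact: IHs. Qed.

(** Each variation flips the sign, so the parity compares the first and last nonzero signs. *)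
Lemma odd_changes_from (x : int) (s : seq int) :
  x != 0 -> odd (changes_from x s) = (x * last_nonzero x s < 0).
Proof.
elim: s x => [|y s IHs] x x_neq0 /=.
  by rewrite ltNge -expr2 sqr_ge0.
case: (eqVneq y 0) => [y0|y_neq0]; first exact: IHs.
rewrite oddD IHs // oddb !sgz_mul_lt0.
have: last_nonzero y s != 0 by exact: last_nonzero_neq0.
move: (last_nonzero y s) => z z_neq0; lia.
Qed.

Lemma last_nonzero_indep (x y z : int) (s : seq int) :
  (0 < changes_from x s)%N -> last_nonzero y s = last_nonzero z s.
Proof.
by elim: s x y z => [|a s IHs] x y z //=; case: eqP => [_|//]; exact: IHs.
Qed.

(* The sign constraints that the coefficients of [p] (sign of [p`_i] in [G i.+1],
   with [G 0 = 0]) impose on those of [('X - alpha) * p] (in [H]), [0 < alpha]. *)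
Definition sign_difference (G H : nat -> int) : Prop :=
  forall i, [/\ (G i.+1 = 0 -> H i = G i), (G i = 0 -> H i = - G i.+1)
              & (G i * G i.+1 < 0 -> H i = G i)].

(** * Effect of a positive linear factor on sign variations *)

Section SignDifference.
Variables (G H : nat -> int).
Hypothesis GH : sign_difference G H.

Let S (f : nat -> int) k n := map f (iota k n).

(** Two states are followed, [x] being the last nonzero entry of [H]. If [x] is opposite to [G k],
    then [H] owes a change to the sign of [G k], made at the latest when [G] vanishes or changes
    sign. If [G k = 0], the next nonzero entry of [G] enters [H] negated, which leads to the first
    state. *)
Lemma changes_from_difference (n k : nat) :
  G (k + n)%N = 0 ->
  (forall x : int, x * G k < 0 ->
     (changes_from (G k) (S G k.+1 n) < changes_from x (S H k n))%N
     /\ last_nonzero x (S H k n) = last_nonzero (G k) (S G k.+1 n)) /\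
  (G k = 0 -> forall x : int, x != 0 ->
     (changes_from x (S G k.+1 n) <= changes_from x (S H k n))%N
     /\ last_nonzero x (S H k n) = last_nonzero x (S G k.+1 n)).
Proof.
elim: n k => [|n IHn] k; first by rewrite addn0 => ->; split=> // x; rewrite mulr0.
rewrite -addSnnS => /IHn[IHA IHB]; have [H1 H2 H3] := GH k.
rewrite /S /= -!/(S _ _ _); split=> [x xG|Gk x x0].
- have Gk0 : G k != 0 by apply: contraTneq xG => ->; rewrite mulr0.
  case: (eqVneq (G k.+1) 0) => [G1|G1].
    rewrite H1 // (negPf Gk0) xG add1n ltnS; exact: IHB.
  case: (boolP (G k * G k.+1 < 0)) => [GG|GG].
    by rewrite H3 // (negPf Gk0) xG /= !add1n !ltnS; apply: IHA.
  have xG1 : x * G k.+1 < 0 by move: xG GG; rewrite !sgz_mul_lt0; lia.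
  (* [G k.+1] has the sign of [G k] here and [H k] may be anything; if it already has that sign, the
     change gained pays for restarting from [H k] instead of [x]. *)
  rewrite add0n; case: (eqVneq (H k) 0) => [_|Hk]; first exact: IHA.
  case: (boolP (x * H k < 0)) => [xH|xH].
    have [le_x <-] := IHA x xG1.
    split; last by apply: (last_nonzero_indep _ _ _ _ (leq_ltn_trans _ le_x)).
    by rewrite add1n (leq_trans le_x) // changes_from_le.
  rewrite add0n; apply: IHA; move: xG1 xH; rewrite !sgz_mul_lt0; lia.
- rewrite H2 // oppr_eq0; case: (eqVneq (G k.+1) 0) => [G1|G1].
    exact: IHB.
  have /IHA[le_G eG] : - G k.+1 * G k.+1 < 0 by rewrite sgz_mul_lt0; lia.
  split=> //.
  rewrite mulrN oppr_lt0; case: (boolP (0 < _)) => xG.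
    by rewrite ltNge ltW //= add1n; apply/ltnW/ltnW.
  by case: (x * _ < 0); [exact: le_G | exact: ltnW].
Qed.

(** [H] starts with the sign opposite to the first nonzero entry of [G], while both end with the
    same sign; hence the strict inequality and the opposite parities. *)
Lemma variations_difference (n k : nat) :
  G k = 0 -> G (k + n)%N = 0 -> has (fun i => G i != 0) (iota k.+1 n) ->
  (variations (S G k.+1 n) < variations (S H k n))%N
  /\ odd (variations (S H k n)) = ~~ odd (variations (S G k.+1 n)).
Proof.
elim: n k => [//|n IHn] k Gk; rewrite -addSnnS => GE.
have [_ H2 _] := GH k; rewrite /S /= -!/(S _ _ _) !variations_cons H2 // oppr_eq0.
case: (eqVneq (G k.+1) 0) => [G1|G1] /=; first exact: IHn.
move=> _; have [/(_ (- G k.+1))] := changes_from_difference n k.+1 GE.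
case=> [|lt_GH eq_last _]; first by rewrite sgz_mul_lt0; lia.
split=> //; rewrite !odd_changes_from ?oppr_eq0 // eq_last.
have: last_nonzero (G k.+1) (S G k.+2 n) != 0 by exact: last_nonzero_neq0.
move: (last_nonzero _ _) => z z_neq0; rewrite !sgz_mul_lt0; lia.
Qed.
End SignDifference.

Lemma variations_iota (f : nat -> int) (n N : nat) :
  (n <= N)%N -> (forall i, (n <= i)%N -> f i = 0) ->
  variations (map f (iota 0 N)) = variations (map f (iota 0 n)).
Proof.
move=> le_nN f0; rewrite /variations -{1}(subnKC le_nN) iotaD map_cat filter_cat.
rewrite [X in _ ++ X](_ : _ = [::]) ?cats0 //; apply/eqP.
rewrite -[_ == _]negbK -has_filter -all_predC all_map; apply/allP => i /=.
by rewrite mem_iota => /andP[/f0 -> _]; rewrite eqxx.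
Qed.

Lemma has_variations (s : seq int) : (0 < variations s)%N -> has (fun x => x != 0) s.
Proof. by rewrite has_filter /variations; case: filter. Qed.

Lemma last_nonzero_iota (f : nat -> int) (k n : nat) :
  f k != 0 ->
  exists b, [/\ (k <= b)%N, f b != 0, last_nonzero (f k) (map f (iota k.+1 n)) = f b
              & forall i, (b < i <= k + n)%N -> f i = 0].
Proof.
move=> fk; elim: n => [|n [b [kb fb eb b_max]]].
  by exists k; split=> // i; rewrite addn0 => /andP[] /leq_trans/[apply]; rewrite ltnn.
rewrite -[n.+1]addn1 iotaD map_cat /last_nonzero foldl_cat /=.
rewrite -/(last_nonzero _ _) eb addn1 addSnnS; case: (eqVneq (f (k + n.+1)%N) 0) => [f0|f0].
  exists b; split=> // i; rewrite [(i <= _)%N]leq_eqVlt.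
  by case: eqP => [->//|_]; rewrite /= addnS ltnS; exact: b_max.
exists (k + n.+1)%N; split=> //; first exact: leq_addr.
by move=> i /andP[] /leq_trans/[apply]; rewrite ltnn.
Qed.

(** For the signs along a face, [a] and [b] are the ends of an edge, and the parity reduces to the
    two end signs. *)
Lemma support_ends (f : nat -> int) (n : nat) :
  (forall i, (n <= i)%N -> f i = 0) -> (exists i, f i != 0) ->
  exists a b, [/\ f a != 0, f b != 0, (forall i, f i != 0 -> (a <= i <= b)%N)
    & odd (variations (map f (iota 0 n))) = (f a * f b < 0)].
Proof.
move=> f0 exf; pose a := ex_minn exf.
have [fa a_min] : f a != 0 /\ forall i, f i != 0 -> (a <= i)%N.
  by rewrite /a; case: ex_minnP.
have lt_an : (a < n)%N by rewrite ltnNge; apply: contra fa => /f0 ->.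
have [b [_ fb eb b_max]] := last_nonzero_iota f a (n - a.+1) fa.
exists a, b; split=> //.
  move=> i fi; rewrite a_min //= leqNgt; apply: contra fi => lt_bi.
  case: (ltnP i n) => [lt_in|/f0 -> //]; apply/eqP/b_max.
  by rewrite lt_bi -ltnS -addSn subnKC.
rewrite -eb -odd_changes_from //; congr odd.
rewrite -{1}(subnKC (ltnW lt_an)) iotaD map_cat -subnSK //=.
rewrite /variations filter_cat [X in X ++ _](_ : _ = [::]) /=.
  by rewrite -/(filter _ (f a :: _)) -/(variations (f a :: _)) variations_cons (negPf fa).
apply/eqP; rewrite -[_ == _]negbK -has_filter -all_predC all_map.
apply/allP => i /=; rewrite mem_iota /= => lt_ia; rewrite negbK.
by apply: contraTT lt_ia => /a_min; rewrite -leqNgt.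
Qed.

Lemma sign_changes_poly (n : nat) (E : nat -> int) :
  sign_changes (\poly_(i < n) E i) = variations (map E (iota 0 n)).
Proof.
set p := \poly_(i < n) E i; rewrite -[LHS]/(variations p).
rewrite -[p : seq int](mkseq_nth 0) -(variations_iota _ _ n) ?size_poly //.
  by congr variations; apply/eq_in_map => i; rewrite mem_iota coef_poly => /andP[_ ->].
by move=> i /leq_sizeP ->.
Qed.

(** * Ordered and real-closed fields *)

Lemma sgzD (K : realDomainType) (x y : K) : `|y| < `|x| -> sgz (x + y) = sgz x.
Proof.
rewrite ltr_norml; case: (sgrP x) => [->|x0|x0]; rewrite ?normr0.
- by move=> /andP[y1 y2]; have := lt_trans y1 y2; rewrite oppr0 ltxx.
- by move=> ?; rewrite !gtr0_sgz //; lra.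
- by move=> ?; rewrite !ltr0_sgz //; lra.
Qed.

Lemma exists_root_pow (K : rcfType) (c : K) (k : nat) : 0 < c -> (0 < k)%N ->
  exists2 y : K, 0 < y & y ^+ k = c.
Proof.
move=> c_gt0 k_gt0.
(* [[0, 1 + c]] brackets the root because [c <= 1 + c <= (1 + c) ^+ k]. *)
have le0c : 0 <= 1 + c by lra.
have [|y /andP[y_ge0 _]] := @poly_ivt K ('X^k - c%:P) 0 (1 + c) le0c.
  rewrite !hornerE expr0n eqn0Ngt k_gt0 sub0r oppr_le0 ltW //= subr_ge0.
  by apply: (@le_trans _ _ (1 + c)); [lra | apply: ler_eXnr => //; lra].
rewrite rootE !hornerE subr_eq0 => /eqP yk; exists y => //.
rewrite lt_def y_ge0 andbT; apply: contraTneq c_gt0 => y0.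
by rewrite -yk y0 expr0n eqn0Ngt k_gt0 ltxx.
Qed.

Lemma poly_ivt_mul (K : rcfType) (p : {poly K}) (a b : K) : a <= b -> p.[a] * p.[b] <= 0 ->
  exists2 x, a <= x <= b & root p x.
Proof.
move=> le_ab; case: (ltrgt0P p.[a]) => [pa|pa|/eqP pa].
- rewrite pmulr_rle0 // => pb.
  have [|x x_ab] := @poly_ivt K (- p) a b le_ab; last by rewrite rootN; exists x.
  by rewrite !hornerN oppr_le0 oppr_ge0 (ltW pa).
- rewrite nmulr_rle0 // => pb; apply: poly_ivt => //.
  by rewrite (ltW pa).
- by exists a; rewrite ?lexx.
Qed.

(** * Valuations compatible with the order *)

Section Valuation.
Variables (R : realType) (K : rcfType) (v : K -> R).
Hypotheses (v_val : is_valuation v) (v_convex : valring_convex v).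
Implicit Types (x y : K) (t u w m : R) (p : {poly K}).

Lemma valM x y : x != 0 -> y != 0 -> v (x * y) = v x + v y.
Proof. by case: v_val => + _; apply. Qed.

Lemma val1 : v 1 = 0.
Proof.
by apply/(addrI (v 1)); rewrite addr0 -valM ?oner_neq0 // mulr1.
Qed.

Lemma valN x : x != 0 -> v (- x) = v x.
Proof.
have N1 : (-1 : K) != 0 by rewrite oppr_eq0 oner_neq0.
have : v (-1) + v (-1) = 0 by rewrite -valM // mulrNN mulr1 val1.
by move=> vN1 x0; rewrite -mulN1r valM //; lra.
Qed.

Lemma valX x i : x != 0 -> v (x ^+ i) = i%:R * v x.
Proof.
move=> x0; elim: i => [|i IHi]; first by rewrite expr0 val1 mul0r.
by rewrite exprS valM ?expf_neq0 // IHi -natr1 mulrDl mul1r addrC.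
Qed.

(** The quotient [x / y] lies between -1 and 1, so convexity puts it in the valuation ring. *)
Lemma val_anti x y : x != 0 -> y != 0 -> `|x| <= `|y| -> v y <= v x.
Proof.
move=> x0 y0 le_xy; have xy0 : x / y != 0 by rewrite mulf_neq0 ?invr_eq0.
have := @v_convex 1 (x / y); rewrite /in_valring val1 lexx orbT -ler_norml.
rewrite normf_div ler_pdivrMr ?normr_gt0 // mul1r (negPf xy0) => /(_ isT le_xy).
by have := valM _ _ xy0 y0; rewrite divfK // => ->; rewrite lerDr.
Qed.

Lemma val_norm x : x != 0 -> v `|x| = v x.
Proof.
move=> x0; apply/le_anti/andP.
by split; apply: val_anti; rewrite ?normr_eq0 ?normr_id.
Qed.

(** Zero is treated as having value +oo, since [v 0] is arbitrary. *)
Definition vge t x : bool := (x == 0) || (t <= v x).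

(** For [vge t x], this is the sign of [x] up to terms of value above [t], which count as zero. *)
Definition lsg t x : int := if (x != 0) && (v x == t) then sgz x else 0.

Lemma vge0 t : vge t 0. Proof. by rewrite /vge eqxx. Qed.

Lemma lsg0 t : lsg t 0 = 0. Proof. by rewrite /lsg eqxx. Qed.

Lemma lsg_neq0 t x : (lsg t x != 0) = (x != 0) && (v x == t).
Proof.
rewrite /lsg; case: (eqVneq x 0) => //= x0.
by case: (v x == t); rewrite ?eqxx // sgz_eq0 x0.
Qed.

Lemma lsg_sgz t x : lsg t x != 0 -> lsg t x = sgz x.
Proof. by rewrite lsg_neq0 /lsg => ->. Qed.

Lemma vgeN t x : vge t (- x) = vge t x.
Proof. by rewrite /vge oppr_eq0; case: eqP => //= /eqP x0; rewrite valN. Qed.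

Lemma lsgN t x : lsg t (- x) = - lsg t x.
Proof.
rewrite /lsg oppr_eq0; case: (eqVneq x 0) => //= x0; rewrite valN //.
by case: ifP; rewrite ?oppr0 // sgzN.
Qed.

Lemma vgeD t x y : vge t x -> vge t y -> vge t (x + y).
Proof.
rewrite /vge; case: (eqVneq x 0) => [->|x0] /=; first by rewrite add0r.
case: (eqVneq y 0) => [->|y0] /=; first by rewrite addr0 (negPf x0).
case: (eqVneq (x + y) 0) => //= xy0 tx ty.
by case: v_val => _ /(_ x y x0 y0 xy0); apply: le_trans; rewrite le_min tx.
Qed.

Lemma vgeM t u x y : vge t x -> vge u y -> vge (t + u) (x * y).
Proof.
rewrite /vge mulf_eq0; case: (eqVneq x 0) => //= x0; case: (eqVneq y 0) => //= y0.
by rewrite valM //; apply: lerD.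
Qed.

Lemma lsgM t x y : y != 0 -> lsg (t + v y) (x * y) = lsg t x * sgz y.
Proof.
move=> y0; rewrite /lsg mulf_eq0 (negPf y0) orbF; case: (eqVneq x 0) => [|x0] /=.
  by rewrite mul0r.
by rewrite valM // (inj_eq (addIr _)); case: ifP; rewrite ?mul0r // sgzM.
Qed.

Lemma ltr_lsg t x y : lsg t x != 0 -> vge t y -> lsg t y = 0 -> `|y| < `|x|.
Proof.
rewrite lsg_neq0 /vge => /andP[x0 /eqP <-] + /eqP.
case: (eqVneq y 0) => [->|y0]; first by rewrite normr0 normr_gt0.
rewrite -[_ == 0]negbK lsg_neq0 y0 /= => le_xy neq_xy.
rewrite ltNge; apply: contra neq_xy => /(val_anti _ _ x0 y0) le_yx.
by rewrite eq_le le_yx.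
Qed.

Definition vgt t x : bool := (x == 0) || (t < v x).

Lemma vgtE t x : vgt t x = vge t x && (lsg t x == 0).
Proof.
rewrite /vgt /vge -[lsg t x == 0]negbK lsg_neq0; case: eqP => //= _.
by rewrite lt_def andbC.
Qed.

Lemma vgtN t x : vgt t (- x) = vgt t x.
Proof. by rewrite !vgtE vgeN lsgN oppr_eq0. Qed.

Lemma vgtD t x y : vgt t x -> vgt t y -> vgt t (x + y).
Proof.
rewrite /vgt; case: (eqVneq x 0) => [->|x0] /=; first by rewrite add0r.
case: (eqVneq y 0) => [->|y0] /=; first by rewrite addr0 (negPf x0).
case: (eqVneq (x + y) 0) => //= xy0 tx ty.
by case: v_val => _ /(_ x y x0 y0 xy0); apply: lt_le_trans; rewrite lt_min tx.
Qed.

Lemma vgt_sum t I (r : seq I) (P : pred I) (F : I -> K) :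
  (forall i, P i -> vgt t (F i)) -> vgt t (\sum_(i <- r | P i) F i).
Proof.
by move=> H; apply: (big_ind (vgt t)) => //; [rewrite /vgt eqxx | exact: vgtD].
Qed.

Lemma vge_sum t I (r : seq I) (P : pred I) (F : I -> K) :
  (forall i, P i -> vge t (F i)) -> vge t (\sum_(i <- r | P i) F i).
Proof. by move=> H; apply: (big_ind (vge t)) => //; [exact: vge0 | exact: vgeD]. Qed.

Lemma lsgD_vgt t x y : vge t x -> vgt t y -> lsg t (x + y) = lsg t x.
Proof.
move=> vx vy; case: (eqVneq (lsg t x) 0) => [sx|sx].
  have /vgtD/(_ vy) : vgt t x by rewrite vgtE vx sx.
  by rewrite vgtE sx => /andP[_ /eqP].
(* Otherwise [x = (x + y) - y] would itself have value above [t]. *)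
have : ~~ vgt t (x + y).
  apply: contra sx => vxy; have : vgt t (x + y - y) by rewrite vgtD ?vgtN.
  by rewrite addrK vgtE => /andP[].
move: (vy); rewrite !vgtE => /andP[vy' /eqP sy]; rewrite (vgeD _ _ _ vx vy') /= => sxy.
rewrite (lsg_sgz _ _ sxy) (lsg_sgz _ _ sx) sgzD //.
by apply: (ltr_lsg t).
Qed.

(** Terms of equal sign cannot cancel: |x| <= |x + y| keeps the value of the sum from exceeding that
    of [x]. *)
Lemma lsgD_same t x y : vge t x -> vge t y -> 0 < lsg t x * lsg t y ->
  lsg t (x + y) = lsg t x.
Proof.
move=> vx vy sxy.
have sx : lsg t x != 0 by apply: contraTneq sxy => ->; rewrite mul0r.
have sy : lsg t y != 0 by apply: contraTneq sxy => ->; rewrite mulr0.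
have xy : 0 < x * y by rewrite -sgz_gt0 sgzM -(lsg_sgz _ _ sx) -(lsg_sgz _ _ sy).
have [xy0 le_xy sg] : [/\ x + y != 0, `|x| <= `|x + y| & sgz (x + y) = sgz x].
  move: xy; case: (sgrP x) => [->|x0|x0]; rewrite ?mul0r ?ltxx //.
    rewrite pmulr_rgt0 // => y0; have xy0 := addr_gt0 x0 y0.
    by rewrite !gtr0_sgz // !gtr0_norm // gt_eqF // lerDl ltW.
  rewrite nmulr_rgt0 // => y0; have xy0 : x + y < 0 by lra.
  by rewrite !ltr0_sgz // !ltr0_norm // lt_eqF // lerN2 gerDl ltW.
move: (sx); rewrite lsg_neq0 => /andP[x0 /eqP vxt].
have sxy' : lsg t (x + y) != 0.
  rewrite lsg_neq0 xy0 eq_le -{1}vxt val_anti //=.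
  by have := vgeD _ _ _ vx vy; rewrite /vge (negPf xy0).
by rewrite (lsg_sgz _ _ sxy') (lsg_sgz _ _ sx).
Qed.

(* The edge of [p] whose slope is [- w] consists of the [i] at which the minimum
   [m] of [v p`_i + i w] is attained. *)
Definition face w m p (i : nat) : int := lsg (m - i%:R * w) p`_i.

Definition above w m p : Prop := forall i, vge (m - i%:R * w) p`_i.

Lemma face_out w m p (i : nat) : (size p <= i)%N -> face w m p i = 0.
Proof. by rewrite /face => /leq_sizeP -> //; rewrite lsg0. Qed.

(** * Faces of a polynomial and their behaviour under products *)

Lemma above_exists w p :
  p != 0 -> exists2 m, above w m p & exists i, face w m p i != 0.
Proof.
move=> p0; have sp : ((size p).-1 < size p)%N by rewrite prednK // size_poly_gt0.
pose F (i : 'I_(size p)) := v p`_i + i%:R * w.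
pose P (i : 'I_(size p)) := p`_i != 0.
have Psp : P (Ordinal sp) by rewrite /P /= -lead_coefE lead_coef_eq0.
case: (arg_minP F Psp) => i Pi i_min; exists (F i).
- move=> j; rewrite /vge; case: (eqVneq p`_j 0) => //= pj.
  have lt_j : (j < size p)%N by rewrite ltnNge; apply: contra pj => /leq_sizeP ->.
  by rewrite lerBlDr; exact: (i_min (Ordinal lt_j)).
- by exists i; rewrite /face lsg_neq0 [_ != 0]Pi /F addrK eqxx.
Qed.

Lemma above_unique w m m' p i j : above w m p -> above w m' p ->
  face w m p i != 0 -> face w m' p j != 0 -> m = m'.
Proof.
move=> pm pm'; rewrite /face !lsg_neq0 => /andP[pi /eqP vi] /andP[pj /eqP vj].
have := pm j; have := pm' i; rewrite /vge (negPf pi) (negPf pj) /= vi vj; lra.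
Qed.

(** Coefficient i of [q] is p_(i-1) - alpha p_i, both terms having value at least m + w - i w. Their
    leading signs are [G i] and [- G i.+1]; a negligible term drops out and equal signs add up,
    which gives [sign_difference G H]. *)
Lemma face_mul_linear w m p alpha :
  0 < alpha -> v alpha = w -> above w m p -> (exists i, face w m p i != 0) ->
  let q := p * ('X - alpha%:P) in let F := face w m p in
  let H := face w (m + w) q in
  [/\ above w (m + w) q, exists i, H i != 0,
      (variations (map F (iota 0 (size p))) < variations (map H (iota 0 (size q))))%N
    & odd (variations (map H (iota 0 (size q))))
      = ~~ odd (variations (map F (iota 0 (size p))))].
Proof.
move=> alpha_gt0 v_alpha pm [i0 Fi0] q F H; have alpha0 := gt_eqF alpha_gt0.
(* The shifted coefficient is 0 at index 0, so that [G 0 = 0]. *)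
pose c i := if i is j.+1 then p`_j else 0.
have qE i : q`_i = c i - p`_i * alpha.
  by rewrite /q mulrBr coefB coefMX coefMC; case: i.
pose G i := lsg (m + w - i%:R * w) (c i).
have FG i : F i = G i.+1.
  by rewrite /G /F /face /=; congr lsg; rewrite -natr1; ring.
have cG i : vge (m + w - i%:R * w) (c i).
  case: i => [|i]; first exact: vge0.
  by rewrite (_ : _ - _ = m - i%:R * w) ?pm // -natr1; ring.
have lvl i : m + w - i%:R * w = m - i%:R * w + v alpha by rewrite v_alpha; ring.
have dG i : vge (m + w - i%:R * w) (- (p`_i * alpha)).
  by rewrite vgeN lvl vgeM // /vge lexx orbT.
have dS i : lsg (m + w - i%:R * w) (- (p`_i * alpha)) = - G i.+1.
  by rewrite -FG lsgN lvl lsgM ?alpha0 // gtr0_sgz // mulr1.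
have qm : above w (m + w) q by move=> i; rewrite qE vgeD.
have GH : sign_difference G H.
  move=> i; rewrite /H /face qE; split=> [G1|G0|GG].
  - by rewrite lsgD_vgt // vgtE dG dS G1 oppr0 eqxx.
  - by rewrite [c i - _]addrC lsgD_vgt // vgtE cG [lsg _ _]G0 eqxx.
  - by rewrite lsgD_same // dS mulrN oppr_gt0.
pose N := (size p + size q).+1.
have FE : map F (iota 0 N) = map G (iota 1 N).
  by rewrite (iotaDl 1 0) -map_comp; apply: eq_map => i /=.
have := variations_difference G H GH N 0.
rewrite -FE (variations_iota F (size p)) ?leqW ?leq_addr //; last exact: face_out.
rewrite (variations_iota H (size q)) ?leqW ?leq_addl //; last exact: face_out.
have lt_i0 : (i0 < size p)%N.
  by rewrite ltnNge; apply: contra Fi0 => ?; rewrite face_out.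
case=> [| | |lt_FH eo].
- by rewrite /G /= lsg0.
- by rewrite add0n -FG /F face_out ?leq_addr.
- apply/hasP; exists i0.+1; last by rewrite -FG.
  by rewrite mem_iota /= add1n !ltnS (leq_trans (ltnW lt_i0)) ?leq_addr.
split=> //; have /hasP[_ /mapP[i _ ->]] := has_variations _ (leq_ltn_trans (leq0n _) lt_FH).
by exists i.
Qed.

(** * Signs at the two ends of a face *)

Lemma vgt_mul_unit t x y : y != 0 -> v y = 0 -> vgt t (x * y) = vgt t x.
Proof.
move=> y0 vy; rewrite /vgt mulf_eq0 (negPf y0) orbF.
by case: (eqVneq x 0) => //= x0; rewrite valM // vy addr0.
Qed.

(* A Cauchy bound: [t] dominates the terms of index [< b], while those of index
   [> b] are infinitesimal. *)
Lemma dominant_term m (n b : nat) (d : nat -> K) :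
  (b < n)%N -> lsg m (d b) != 0 -> (forall i, vge m (d i)) ->
  (forall i, (i < n)%N -> lsg m (d i) != 0 -> (i <= b)%N) ->
  exists t : K, [/\ 1 <= t, v t = 0 & sgz (\sum_(i < n) d i * t ^+ i) = sgz (d b)].
Proof.
move=> lt_bn db vd d_max; pose ob := Ordinal lt_bn.
have /andP[db0 /eqP vdb] : (d b != 0) && (v (d b) == m) by rewrite -lsg_neq0.
have ndb_gt0 : 0 < `|d b| by rewrite normr_gt0.
pose A := \sum_(i < n | (i != ob) && (i < b)%N) `|d i|.
have A_ge0 : 0 <= A by apply: sumr_ge0 => i _; exact: normr_ge0.
(* With this choice A = |d b| (t - 1), and the lower terms total at most [A * t ^+ b / t]. *)
pose t := 1 + A / `|d b|.
have t_ge1 : 1 <= t by rewrite lerDl divr_ge0 // ltW.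
have t_gt0 : 0 < t by exact: lt_le_trans t_ge1.
have t0 : t != 0 by rewrite gt_eqF.
have AE : A = `|d b| * (t - 1).
  by rewrite /t addrAC subrr add0r mulrC divfK // gt_eqF.
have vA : vge m A.
  apply: vge_sum => i _; have := vd i; rewrite /vge normr_eq0.
  by case: eqVneq => //= di0; rewrite val_norm.
(* [1 <= t] gives [v t <= 0]; conversely [A] has value at least [m = v (d b)], so A / |d b| is in
   the valuation ring. *)
have vt : v t = 0.
  apply/le_anti/andP; split.
    by rewrite -val1 val_anti ?oner_neq0 // normr1 ger0_norm // ltW.
  have : vge 0 t.
    apply: vgeD; first by rewrite /vge val1 lexx orbT.
    move: vA; rewrite /vge mulf_eq0 invr_eq0 (gt_eqF ndb_gt0) orbF.
    case: (eqVneq A 0) => //= A0; have nz : `|d b| != 0 by rewrite gt_eqF.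
    have := valM (A / `|d b|) _ (mulf_neq0 A0 (invr_neq0 nz)) nz.
    by rewrite divfK // val_norm // vdb => ->; rewrite lerDr.
  by rewrite /vge (negPf t0).
have vtX i : v (t ^+ i) = 0 by rewrite valX // vt mulr0.
have tX0 i : t ^+ i != 0 by rewrite expf_neq0.
exists t; split=> //.
rewrite (bigD1 ob) //= (bigID (fun i : 'I_n => (i < b)%N)) /=.
rewrite sgzD; first by rewrite sgzM (gtr0_sgz (exprn_gt0 b t_gt0)) mulr1.
set L := \sum_(i < n | _) _; set H := \sum_(i < n | _) _.
(* [e] is what the bound on the lower terms leaves of |d b| t^b; its value is [m], so the upper
   terms, of value above [m], stay below it. *)
pose e := `|d b| * t ^+ b / t.
have e_gt0 : 0 < e by rewrite divr_gt0 // mulr_gt0 // exprn_gt0.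
have lt_He : `|H| < e.
  have se : lsg m e != 0.
    rewrite lsg_neq0 (gt_eqF e_gt0) /= -vdb -(val_norm _ db0).
    have := valM e t (lt0r_neq0 e_gt0) t0.
    by rewrite divfK // valM ?normr_eq0 // vtX vt !addr0 => <-.
  have := vgt_sum m _ (index_enum 'I_n) (fun i => (i != ob) && ~~ (i < b)%N)
            (fun i => d i * t ^+ i).
  rewrite -/H vgtE -[X in _ < X]ger0_norm ?(ltW e_gt0) // => vH.
  suff /vH/andP[? /eqP ?] : forall i : 'I_n, (i != ob) && ~~ (i < b)%N -> vgt m (d i * t ^+ i).
    exact: (ltr_lsg m).
  move=> i /andP[ib]; rewrite -leqNgt leq_eqVlt => /orP[/eqP bi|lt_bi].
    by case/eqP: ib; apply: val_inj.
  rewrite vgt_mul_unit // vgtE vd -[_ == 0]negbK; apply: contraTN lt_bi => /(d_max _ (ltn_ord i)).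
  by rewrite -leqNgt.
have le_L : `|L| <= A * t ^+ b / t.
  apply: le_trans (ler_norm_sum _ _ _) _; rewrite /A 2!mulr_suml.
  apply: ler_sum => i /andP[_ lt_ib]; rewrite normrM -mulrA ler_wpM2l //.
  rewrite ger0_norm ?exprn_ge0 ?(ltW t_gt0) // ler_pdivlMr // -exprSr.
  exact: ler_weXn2l.
apply: le_lt_trans (ler_normD _ _) _.
rewrite normrM (ger0_norm (ltW (exprn_gt0 b t_gt0))).
have -> : `|d b| * t ^+ b = A * t ^+ b / t + e by rewrite AE /e; field.
exact: ler_ltD.
Qed.

Lemma vge_term w m p x i : x != 0 -> v x = w -> above w m p -> vge m (p`_i * x ^+ i).
Proof.
move=> x0 vx pm; rewrite -[m](subrK (i%:R * w)) vgeM //.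
by rewrite /vge valX // vx lexx orbT.
Qed.

Lemma lsg_term w m p x i : x != 0 -> v x = w ->
  lsg m (p`_i * x ^+ i) = face w m p i * sgz (x ^+ i).
Proof.
move=> x0 vx; rewrite -{1}[m](subrK (v (x ^+ i))) lsgM ?expf_neq0 //.
by rewrite valX // vx.
Qed.

Lemma face_ends_same_sign w m p (a b : nat) :
  above w m p -> face w m p a != 0 -> face w m p b != 0 ->
  (forall i, face w m p i != 0 -> (a <= i <= b)%N) ->
  (forall x, 0 < x -> v x = w -> ~~ root p x) ->
  0 < face w m p a * face w m p b.
Proof.
move=> pm fa fb f_ab no_root; have /andP[le_ab _] := f_ab _ fb.
move: (fa) (fb); rewrite {1 2}/face !lsg_neq0 => /andP[pa /eqP va] /andP[pb /eqP vb].
case: (ltngtP a b) le_ab => // [lt_ab _|-> _]; last by rewrite lt_def mulf_neq0 // -expr2 sqr_ge0.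
have c_gt0 : 0 < `|p`_a / p`_b| by rewrite normr_gt0 mulf_neq0 ?invr_eq0.
(* At this [y] the two end terms have equal absolute value, which forces [v y = w]. *)
have [|y y_gt0 y_pow] := exists_root_pow K _ (b - a) c_gt0; first by rewrite subn_gt0.
have y0 : y != 0 by rewrite gt_eqF.
have vy : v y = w.
  have ba0 : (b%:R - a%:R : R) != 0 by rewrite subr_eq0 eqr_nat gtn_eqF.
  have pab0 : p`_a / p`_b != 0 by rewrite -normr_gt0.
  apply: (mulfI ba0); rewrite -natrB ?(ltnW lt_ab) // -valX // y_pow val_norm //.
  by have := valM _ _ pab0 pb; rewrite divfK // va vb natrB ?(ltnW lt_ab) //; lra.
pose d i := p`_i * y ^+ i.
have vd i : vge m (d i) by exact: vge_term pm.
have sd i : lsg m (d i) = face w m p i.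
  by rewrite (lsg_term w) // gtr0_sgz ?exprn_gt0 ?mulr1.
have lt_size i : face w m p i != 0 -> (i < size p)%N.
  by move=> fi; rewrite ltnNge; apply: contra fi => /face_out ->.
have sgz_d i : face w m p i != 0 -> face w m p i = sgz (d i).
  by rewrite -sd => /lsg_sgz.
have [||||t [t_ge1 vt st]] := dominant_term m (size p) b d; rewrite ?sd ?lt_size //.
  by move=> i _; rewrite sd => /f_ab/andP[].
(* Reversing the coefficients makes [a] the top index of the face, so the same bound serves the low
   end, at [y / u]. *)
have [||||u [u_ge1 vu su]] :=
    dominant_term m (size p) (size p - a.+1) (fun i => d (size p - i.+1)%N).
- by rewrite ltn_subrL size_poly_gt0; apply: contraNneq pa => ->; rewrite coef0.
- by rewrite subnSK ?lt_size // subKn ?sd // ltnW ?lt_size.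
- by [].
- move=> i lt_i; rewrite sd => fi; have /andP[] := f_ab _ fi; have := lt_size _ fi; lia.
move: su; rewrite subnSK ?lt_size // subKn ?(ltnW (lt_size _ fa)) // => su.
have t_gt0 : 0 < t by exact: lt_le_trans t_ge1.
have u_gt0 : 0 < u by exact: lt_le_trans u_ge1.
have hb : sgz p.[y * t] = face w m p b.
  rewrite sgz_d // -st horner_coef; congr sgz; apply: eq_bigr => i _.
  by rewrite exprMn mulrA.
have ha : sgz p.[y / u] = face w m p a.
  rewrite sgz_d // -su -[LHS]mul1r -(gtr0_sgz (exprn_gt0 (size p).-1 u_gt0)) -sgzM.
  congr sgz; rewrite (reindex_inj rev_ord_inj) horner_coef mulr_sumr /=.
  apply: eq_bigr => i _; rewrite subnSK // subKn 1?ltnW // /d exprMn exprVn.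
  have -> : (size p).-1 = (size p - i.+1 + i)%N by move: (size p) i => k [i /= lt_ik]; clear -lt_ik; lia.
  by rewrite exprD; field; rewrite expf_neq0 // gt_eqF.
(* A nonpositive product would give a root between [y / u] and [y * t]; both have value [w], hence
   so does the root. *)
rewrite ltNge; apply/negP => sgn_ab.
have le_yy : y / u <= y * t.
  apply: (@le_trans _ _ y); first by rewrite ler_pdivrMr // ler_peMr // ltW.
  by rewrite ler_peMr // ltW.
have [x /andP[le_x x_le] px] : exists2 x, y / u <= x <= y * t & root p x.
  move: sgn_ab; rewrite -ha -hb -sgzM sgz_le0; exact: poly_ivt_mul.
have vyt : v (y * t) = w by rewrite valM ?vt ?addr0 // gt_eqF.
have vyu : v (y / u) = w.
  have yu0 : y / u != 0 by rewrite mulf_neq0 ?invr_eq0 // gt_eqF.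
  by have := valM _ u yu0; rewrite divfK ?gt_eqF // vu addr0 vy => ->.
have yu_gt0 : 0 < y / u by rewrite divr_gt0.
have x_gt0 : 0 < x by exact: lt_le_trans le_x.
apply/negP: px; apply: no_root => //; apply/le_anti/andP; split.
- by rewrite -vyu val_anti ?gt_eqF // !gtr0_norm.
- by rewrite -vyt val_anti ?gt_eqF ?mulr_gt0 // !gtr0_norm // mulr_gt0.
Qed.

(** * Counting roots along an edge *)

Lemma even_variations_face w m p :
  above w m p -> (exists i, face w m p i != 0) ->
  (forall x, 0 < x -> v x = w -> ~~ root p x) ->
  ~~ odd (variations (map (face w m p) (iota 0 (size p)))).
Proof.
move=> pm exf no_root.
have [a [b [fa fb f_ab ->]]] := support_ends _ (size p) (face_out w m p) exf.
by rewrite -leNgt ltW // face_ends_same_sign.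
Qed.

(** Each factor adds an unspecified positive odd number of variations, so only a lower bound and a
    parity are carried along. The level grows by [w] per factor, hence the existential [m']. *)
Lemma variations_face_mul w (s : seq K) (n : nat) m p :
  {in s, forall alpha, 0 < alpha /\ v alpha = w} ->
  above w m p -> (exists i, face w m p i != 0) ->
  let V := variations (map (face w m p) (iota 0 (size p))) in
  (n <= V)%N -> odd V = odd n ->
  let q := p * \prod_(alpha <- s) ('X - alpha%:P) in
  exists m', [/\ above w m' q, exists i, face w m' q i != 0 &
    let V' := variations (map (face w m' q) (iota 0 (size q))) in
    (n + size s <= V')%N /\ odd V' = odd (n + size s)].
Proof.
elim: s n m p => [|alpha s IHs] n m p s_w pm exf V le_nV odd_V.
  by rewrite big_nil mulr1 addn0; exists m.
have [alpha_gt0 v_alpha] := s_w _ (mem_head _ _).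
have [qm exq lt_V odd_q] := face_mul_linear w m p alpha alpha_gt0 v_alpha pm exf.
rewrite big_cons mulrA addnS -addSn; apply: (IHs _ _ _ _ qm exq).
- by move=> x xs; apply: s_w; rewrite inE xs orbT.
- exact: leq_ltn_trans lt_V.
- by rewrite odd_q -/V odd_V.
Qed.

Lemma root_on_edge p alpha : p != 0 -> root p alpha -> alpha != 0 ->
  exists a b, np_edge v p a b /\ v alpha = - np_slope v p a b.
Proof.
move=> p0 p_alpha alpha0; set w := v alpha.
have [m pm exf] := above_exists w p p0.
have [a [b [fa fb f_ab _]]] := support_ends _ (size p) (face_out w m p) exf.
have lt_b : (b < size p)%N by rewrite ltnNge; apply: contra fb => /face_out ->.
move: (fa) (fb); rewrite {1 2}/face !lsg_neq0 => /andP[pa /eqP va] /andP[pb /eqP vb].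
have lt_ab : (a < b)%N.
  have /andP[_ le_ab] := f_ab _ fa; rewrite ltn_neqAle le_ab andbT.
  apply/negP => /eqP eq_ab.
  (* If [a = b], exactly one term at [alpha] has value [m] and the rest is negligible, so the sum
     cannot vanish. *)
  move: p_alpha; rewrite rootE horner_coef (bigD1 (Ordinal (leq_ltn_trans le_ab lt_b))) //=.
  set r := \sum_(i < _ | _) _ => /eqP s0.
  have vr : vgt m r.
    apply: vgt_sum => i ia; rewrite vgtE (vge_term w) // (lsg_term w) //.
    rewrite (_ : face w m p i = 0) ?mul0r ?eqxx //; apply: contraNeq ia => /f_ab.
    by move=> /andP[le_ai]; rewrite -val_eqE /= eqn_leq le_ai -{1}eq_ab andbT.
  have := lsgD_vgt m (p`_a * alpha ^+ a) r (vge_term w m p alpha a alpha0 erefl pm) vr.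
  rewrite s0 lsg0 (lsg_term w) // => /esym/eqP.
  by rewrite mulf_eq0 (negPf fa) sgz_eq0 expf_eq0 (negPf alpha0) andbF.
have ba0 : (b%:R - a%:R : R) != 0 by rewrite subr_eq0 eqr_nat gtn_eqF.
have slope : np_slope v p a b = - w.
  by rewrite /np_slope va vb; field.
exists a, b; split; last by rewrite slope opprK.
have lineE (i : nat) : v p`_a + np_slope v p a b * (i%:R - a%:R) = m - i%:R * w.
  by rewrite slope va; ring.
split=> //; split=> //; split=> //; split=> //; split=> i.
  by rewrite lineE => pi; have := pm i; rewrite /vge (negPf pi).
by rewrite /np_on_line lineE -lsg_neq0; exact: f_ab.
Qed.

(** Turns an edge given by its endpoints into a face: [m] is the height at index 0 of the line
    through the edge. *)
Lemma sign_changes_edge_poly p (a b : nat) : np_edge v p a b ->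
  let w := - np_slope v p a b in
  exists m, [/\ above w m p, exists i, face w m p i != 0 &
    sign_changes (np_edge_poly v p a b)
      = variations (map (face w m p) (iota 0 (size p)))].
Proof.
move=> [_ [_ [pa [_ [p_line _]]]]] w; exists (v p`_a + a%:R * w).
have lineE (i : nat) :
    v p`_a + np_slope v p a b * (i%:R - a%:R) = v p`_a + a%:R * w - i%:R * w.
  by rewrite /w; ring.
split.
- move=> i; rewrite /vge; case: eqVneq => //= pi.
  by rewrite -lineE; exact: p_line.
- by exists a; rewrite /face lsg_neq0 pa addrK eqxx.
rewrite sign_changes_poly; congr variations; apply: eq_map => i.
by rewrite /face /lsg /np_on_line lineE.
Qed.

End Valuation.

Theorem theoremB (R : realType) (K : rcfType) (v : K -> R)
    (P Q : {poly K}) (s : seq K) :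
  is_valuation v -> valring_convex v -> P != 0 ->
  P = lead_coef P *: (Q * \prod_(alpha <- s) ('X - alpha%:P)) ->
  (forall x : K, ~~ root Q x) ->
  (forall alpha, alpha \in s -> alpha != 0 ->
     exists a b, np_edge v P a b /\ v alpha = - np_slope v P a b) /\
  (forall a b, np_edge v P a b ->
     let npos := count (fun alpha => (0 < alpha) && (v alpha == - np_slope v P a b)) s in
     let d := sign_changes (np_edge_poly v P a b) in
     (npos <= d)%N /\ ~~ odd (d - npos)).
Proof.
move=> v_val v_convex P0 PE Q_root; split.
  move=> alpha alpha_s; apply: root_on_edge => //.
  by rewrite PE rootZ ?lead_coef_eq0 // rootM root_prod_XsubC alpha_s orbT.
move=> a b edge; set w := - np_slope v P a b.
set good := fun alpha => _; move=> npos d.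
(* [B] keeps [Q] and all roots except the positive ones of value [w], so its count is even. *)
pose B := lead_coef P *: Q * \prod_(alpha <- s | ~~ good alpha) ('X - alpha%:P).
have PB : P = B * \prod_(alpha <- [seq x <- s | good x]) ('X - alpha%:P).
  rewrite {1}PE (bigID good) /= big_filter /B -!scalerAl -mulrA.
  by congr (_ *: (_ * _)); rewrite mulrC.
have B0 : B != 0 by apply: contraNneq P0 => B0; rewrite PB B0 mul0r.
have B_root x : 0 < x -> v x = w -> ~~ root B x.
  move=> x_gt0 vx; rewrite rootM rootZ ?lead_coef_eq0 // (negPf (Q_root x)) /=.
  rewrite -big_filter root_prod_XsubC mem_filter /good x_gt0 -/w vx eqxx //.
have [m Bm exB] := above_exists R K v w B B0.
have [||m' [Pm' [j fj] le_odd]] :=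
    variations_face_mul R K v v_val v_convex w [seq x <- s | good x] 0 m B _ Bm exB (leq0n _) _.
- by move=> x; rewrite mem_filter => /andP[/andP[x_gt0 /eqP vx] _].
- exact/negbTE/even_variations_face.
have [m2 [Pm2 [i fi] dE]] := sign_changes_edge_poly R K v P a b edge.
rewrite -PB in Pm' fj le_odd.
(* The level reached by multiplication and the one read off the edge agree, since both lines have
   slope [- w] and touch the points of [P]. *)
have em := above_unique R K v w m2 m' P i j Pm2 Pm' fi fj.
move: le_odd; rewrite -em -dE -/d add0n size_filter -/npos => -[le_npos odd_d].
by rewrite oddB // odd_d addbb.
Qed.
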